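(* There is a continuous flow of unit rectangles in $\Pi$ that is a conformal solution for $\mathbf{C}$ and passes through rectangles at infinity for $\mathbf{C}$.
   Context: Setting. $A,B,C,D$ are lines in $\mathbb{R}^2$ with equations $A: y=m_Ax+b_A$, $B: y=m_Bx+1$, $C: y=m_Cx$, $D: y=m_Dx$ (real $m_A,m_B,m_C,m_D,b_A$), such that the four lines do not all meet in a single point and $C,D$ meet in the origin and only in the origin. $\mathbf{C}$ denotes the configuration consisting of the two pairs $A,C$ and $B,D$. For $w\in\mathbb{R}$: $A(w): y=m_Ax+b_Aw$, $B(w): y=m_Bx+w$, $C(w)=C$, $D(w)=D$, and $\mathbf{C}(w)$ is the resulting configuration. A parallelogram inscribed in $\mathbf{C}(w)$ has vertices $(x_L,y_L)\in L(w)$, $L\in\{A,B,C,D\}$, in this sequence, i.e. $(x_A,y_A)+(x_C,y_C)=(x_B,y_B)+(x_D,y_D)$; degenerate parallelograms (all sides on one line, or a single point) are allowed. $\Pi$ is the set of parallelograms inscribed in $\mathbf{C}(w)$ for some $w\in\mathbb{R}$ ($w$ is then the scale), a three-dimensional real vector space under coordinatewise operations on vertices. Those of scale $1$ are inscribed in $\mathbf{C}$; those of scale $0$ are at infinity for $\mathbf{C}$. For $P\in\Pi$, $P_{AC}=(x_A-x_C,y_A-y_C)$ and $P_{BD}=(x_B-x_D,y_B-y_D)$ are the diagonal vectors. The inner product on $\Pi$ is $\langle P,Q\rangle=P_{AC}\cdot Q_{AC}+P_{BD}\cdot Q_{BD}$, with norm $\|P\|=\langle P,P\rangle^{1/2}$.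 A rectangle in $\Pi$ is a parallelogram (possibly degenerate) whose diagonals have equal length; a unit rectangle is a rectangle of norm $1$. A rectangle $R$ is scaled from a rectangle $R'$ (and $R'$ scales to $R$) if $R$ is a scalar multiple of $R'$ in $\Pi$. A conformal solution for $\mathbf{C}$ is a set $\mathcal{R}$ of rectangles in $\Pi$ such that each rectangle $R$ inscribed in $\mathbf{C}$, and each rectangle $R$ at infinity for $\mathbf{C}$, is scaled from a rectangle $R'$ in $\mathcal{R}$, and for all but at most one such rectangle $R$ there is a unique rectangle $R'$ in $\mathcal{R}$ that scales to $R$. Here the rectangles $R$ inscribed in $\mathbf{C}$ or at infinity are understood not to be the zero element of $\Pi$ (the parallelogram all of whose vertices are the origin). A flow on a set $\mathcal{R}$ of rectangles is a map $f:\mathcal{R}\times\mathbb{R}\to\mathcal{R}$ such that $f(R,0)=R$ and $f(f(R,\theta),\rho)=f(R,\theta+\rho)$ for all $R\in\mathcal{R}$ and $\theta,\rho\in\mathbb{R}$. *)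

(* Defs.v *)
From HB Require Import structures.
From mathcomp Require Import all_boot all_order all_algebra.
From mathcomp Require Import all_classical all_reals all_analysis.
Set Implicit Arguments.
Unset Strict Implicit.
Unset Printing Implicit Defensive.
Import Order.TTheory GRing.Theory Num.Theory.
Import numFieldNormedType.Exports.
Local Open Scope classical_set_scope.
Local Open Scope ring_scope.

(* [R^o] rather than [R], so that points and quadruples of points inherit the
   coordinatewise vector space operations and the product topology. *)
Notation plane R := (R^o * R^o)%type.
Notation quad R := (plane R * plane R * plane R * plane R)%type.

Section Geometry.
Variable R : realType.

Definition dot (u v : plane R) : R := u.1 * v.1 + u.2 * v.2.
Definition vlength (u : plane R) : R := Num.sqrt (dot u u).

Definition line (m b : R) : set (plane R) := [set p | p.2 = m * p.1 + b].

Definition vA (P : quad R) : plane R := P.1.1.1.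
Definition vB (P : quad R) : plane R := P.1.1.2.
Definition vC (P : quad R) : plane R := P.1.2.
Definition vD (P : quad R) : plane R := P.2.

Definition diagAC (P : quad R) : plane R := vA P - vC P.
Definition diagBD (P : quad R) : plane R := vB P - vD P.

Definition inner (P Q : quad R) : R :=
  dot (diagAC P) (diagAC Q) + dot (diagBD P) (diagBD Q).
Definition qnorm (P : quad R) : R := Num.sqrt (inner P P).

(* The lines A : y = mA x + bA, B : y = mB x + 1, C : y = mC x, D : y = mD x. *)
Record config := Config { mA : R; mB : R; mC : R; mD : R; bA : R }.

Variable K : config.

Definition lineA (w : R) : set (plane R) := line (mA K) (bA K * w).
Definition lineB (w : R) : set (plane R) := line (mB K) w.
Definition lineC (w : R) : set (plane R) := line (mC K) 0.
Definition lineD (w : R) : set (plane R) := line (mD K) 0.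

Definition inscribed_at (w : R) (P : quad R) : Prop :=
  [/\ lineA w (vA P), lineB w (vB P), lineC w (vC P), lineD w (vD P)
    & vA P + vC P = vB P + vD P].

Definition Pi : set (quad R) := [set P | exists w, inscribed_at w P].

Definition inscribed (P : quad R) : Prop := inscribed_at 1 P.
Definition at_infinity (P : quad R) : Prop := inscribed_at 0 P.

Definition rectangle : set (quad R) :=
  [set P | Pi P /\ vlength (diagAC P) = vlength (diagBD P)].

Definition unit_rectangle : set (quad R) :=
  [set P | rectangle P /\ qnorm P = 1].

Definition scaled_from (P Q : quad R) : Prop := exists c : R, P = c *: Q.

Definition target_rectangle : set (quad R) :=
  [set P | [/\ rectangle P, P != 0 & inscribed P \/ at_infinity P]].

Definition conformal_solution (S : set (quad R)) : Prop :=
  [/\ S `<=` rectangle,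
      forall P, target_rectangle P -> exists2 Q, S Q & scaled_from P Q
    & is_subset1 [set P | target_rectangle P /\
                          ~ exists! Q, S Q /\ scaled_from P Q]].

(* A flow on S is encoded by a function on all of [quad R * R], of which only
   the values on S * R are constrained. *)
Definition flow_on (S : set (quad R)) (f : quad R * R -> quad R) : Prop :=
  [/\ forall P t, S P -> S (f (P, t)),
      forall P, S P -> f (P, 0) = P
    & forall P s t, S P -> f (f (P, s), t) = f (P, s + t)].

Definition continuous_flow_on (S : set (quad R)) (f : quad R * R -> quad R) :
  Prop := flow_on S f /\ {within S `*` setT, continuous f}.

(* Every trajectory is required to reach infinity: the bare existence of one
   such P and t would not involve the flow at all (take t = 0). *)
Definition passes_through_infinity (S : set (quad R))
    (f : quad R * R -> quad R) : Prop :=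
  S !=set0 /\ forall P, S P -> exists t, at_infinity (f (P, t)).

End Geometry.

(* Main.v *)
Require Import Defs.
From HB Require Import structures.
From mathcomp Require Import all_boot all_order all_algebra.
From mathcomp Require Import all_classical all_reals all_analysis.
From mathcomp Require Import ring lra.
Import Order.TTheory GRing.Theory Num.Theory.
Import numFieldNormedType.Exports.
Local Open Scope classical_set_scope.
Local Open Scope ring_scope.

(* The pair of diagonal vectors (u, v) identifies Pi with a hyperplane
   n1 . u + n2 . v = 0 of R^4, in which the rectangles form the cone
   |u| = |v|.  Say |n1| <= |n2|.  Over each u with |u|^2 = 1/2 choose the v of
   the same length that solves the linear equation and lies on a fixed side of
   the line spanned by n2.  If |n1| < |n2|, the resulting closed curve has
   exactly one point on each line of the cone, and rotating u is the flow.  If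
   |n1| = |n2|, the cone consists of two planes, and the curve is half a circle
   in one of them followed by half a circle in the other; its points over
   u and -u for u collinear with n1 are opposite, so one of them is removed, and
   the flow is a translation of the resulting open arc.  Both flows are
   transitive, so it remains to find one nonzero rectangle at infinity.  On the
   plane of scale 0 in Pi one has u x u' = v x v', which prevents the quadratic
   form |u|^2 - |v|^2 from being definite there. *)

Section ConformalFlow.
Variable R : realType.
Implicit Types (u v n : plane R) (t : R).

(** * Flows on a circle and on a punctured circle *)

Definition perp u : plane R := (- u.2, u.1).

Definition rotation (p : plane R * R) : plane R :=
  cos p.2 *: p.1 + sin p.2 *: perp p.1.

Definition is_flow (X : Type) (S : set X) (f : X * R -> X) : Prop :=
  [/\ forall P t, S P -> S (f (P, t)),
      forall P, S P -> f (P, 0) = P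
    & forall P s t, S P -> f (f (P, s), t) = f (P, s + t)].

Definition transitive_flow (X : Type) (S : set X) (f : X * R -> X) : Prop :=
  is_flow X S f /\ forall P Q, S P -> S Q -> exists t, f (P, t) = Q.

Lemma regular_scaleE (a : R) (x : R^o) : a *: x = a * x.
Proof. by []. Qed.

Lemma cvg_perp (T : Type) (F : set_system T) (FF : Filter F)
    (f : T -> plane R) (a : plane R) :
  f @ F --> a -> (fun x => perp (f x)) @ F --> perp a.
Proof.
move=> fa.
have f1 : (fun x => (f x).1) @ F --> a.1 by exact: (cvg_comp _ _ fa cvg_fst).
have f2 : (fun x => (f x).2) @ F --> a.2 by exact: (cvg_comp _ _ fa cvg_snd).
exact: (cvg_pair (cvgN f2) f1).
Qed.

Lemma cvg_dot (T : Type) (F : set_system T) (FF : Filter F)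
    (f g : T -> plane R) (a b : plane R) :
  f @ F --> a -> g @ F --> b -> (fun x => dot (f x) (g x)) @ F --> dot a b.
Proof.
move=> fa gb; apply: cvgD; apply: cvgM.
- exact: (cvg_comp _ _ fa cvg_fst).
- exact: (cvg_comp _ _ gb cvg_fst).
- exact: (cvg_comp _ _ fa cvg_snd).
- exact: (cvg_comp _ _ gb cvg_snd).
Qed.

Lemma rotation_continuous : continuous rotation.
Proof.
move=> p; apply: cvgD; apply: cvgZ.
- by apply: continuous_comp; [exact: cvg_snd|exact: continuous_cos].
- exact: cvg_fst.
- by apply: continuous_comp; [exact: cvg_snd|exact: continuous_sin].
- by apply: cvg_perp; exact: cvg_fst.
Qed.

Lemma cos_sin_surj (c s : R) : c ^+ 2 + s ^+ 2 = 1 ->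
  exists t, cos t = c /\ sin t = s.
Proof.
move=> cs1.
have c1 : -1 <= c <= 1 by apply/andP; split; nra.
have sE : 1 - c ^+ 2 = s ^+ 2 by lra.
case: (leP 0 s) => s0.
  exists (acos c); rewrite acosK ?in_itv//= sin_acos// sE sqrtr_sqr ger0_norm//.
exists (- acos c); rewrite cosN sinN acosK ?in_itv//= sin_acos// sE sqrtr_sqr.
by rewrite ltr0_norm// opprK.
Qed.

Lemma rotation_flow : transitive_flow _ [set u | dot u u = 2^-1] rotation.
Proof.
split; first split.
- move=> [x y] t /=; rewrite /dot/= => xy.
  have := cos2Dsin2 t.
  rewrite /= !regular_scaleE; nra.
- by move=> [x y] _; rewrite /rotation cos0 sin0 scale1r scale0r addr0.
- move=> [x y] s t _; rewrite /rotation/= cosD sinD.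
  by congr pair; rewrite /= !regular_scaleE; ring.
move=> [x y] [x' y'] /=; rewrite /dot/= => xy xy'.
(* The cosine and sine of the oriented angle from the first vector to the second; the factor 2
   compensates for the squared lengths 1/2. *)
have [|t [ct st]] :=
  @cos_sin_surj (2 * (x * x' + y * y')) (2 * (x * y' - y * x')).
  transitivity (4 * (x * x + y * y) * (x' * x' + y' * y')); first by ring.
  by rewrite xy xy'; field.
exists t; rewrite /rotation/= ct st; congr pair; rewrite /= !regular_scaleE.
  transitivity (2 * (x * x + y * y) * x'); first by ring.
  by rewrite xy; field.
transitivity (2 * (x * x + y * y) * y'); first by ring.
by rewrite xy; field.
Qed.

(* Translation of tan (alpha / 2), where alpha is the angle from a. *)
Definition parabolic a (p : plane R * R) : plane R :=
  let t := 2 * dot (perp a) p.1 / (1 + 2 * dot a p.1) + p.2 in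
  ((1 - t ^+ 2) / (1 + t ^+ 2)) *: a + (2 * t / (1 + t ^+ 2)) *: perp a.

Lemma parabolic_continuous a p : 1 + 2 * dot a p.1 != 0 ->
  {for p, continuous (parabolic a)}.
Proof.
move=> ap0; rewrite /parabolic.
have tc : (fun p => 2 * dot (perp a) p.1 / (1 + 2 * dot a p.1) + p.2)
    @ p --> 2 * dot (perp a) p.1 / (1 + 2 * dot a p.1) + p.2.
  apply: cvgD; last exact: cvg_snd.
  have lin b : 2 * dot b q.1 @[q --> p] --> 2 * dot b p.1.
    apply: cvgM; first exact: cvg_cst.
    by apply: cvg_dot; [exact: cvg_cst|exact: cvg_fst].
  apply: cvgM => //.
  by apply: cvgV => //; apply: cvgD => //; exact: cvg_cst.
move: tc; set t := fun p => _ => tc.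
have t20 : 1 + t p ^+ 2 != 0 by rewrite gt_eqF// ltr_wpDr ?sqr_ge0.
have t2 : (fun p => 1 + t p ^+ 2) @ p --> 1 + t p ^+ 2.
  by apply: cvgD; [exact: cvg_cst|exact: cvgM].
apply: cvgD; apply: cvgZ; try exact: cvg_cst.
  apply: cvgM; last exact: cvgV.
  by apply: cvgB; [exact: cvg_cst|exact: cvgM].
apply: cvgM; last exact: cvgV.
by apply: cvgM; [exact: cvg_cst|].
Qed.

(** As [dot a a = 2^-1], the numbers [2 * dot a u] and [2 * dot (perp a) u] are cos alpha and sin
    alpha, and their combination sin alpha / (1 + cos alpha) = tan (alpha / 2) identifies the circle
    without [- a] with the real line. *)
Lemma parabolic_flow a : dot a a = 2^-1 ->
  transitive_flow _ [set u | dot u u = 2^-1 /\ 1 + 2 * dot a u != 0]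
    (parabolic a).
Proof.
move=> a1.
(* [gE] and [uE] state that the rational parametrization and the coordinate tan (alpha / 2) are
   inverse to each other. *)
have gE (t : R) : let u := ((1 - t ^+ 2) / (1 + t ^+ 2)) *: a +
      (2 * t / (1 + t ^+ 2)) *: perp a : plane R in
    [/\ dot u u = 2^-1, 1 + 2 * dot a u != 0 &
      2 * dot (perp a) u / (1 + 2 * dot a u) = t].
  have t20 : 1 + t ^+ 2 != 0 by rewrite gt_eqF// ltr_wpDr ?sqr_ge0.
  set u := _ + _ => /=.
  have au : dot a u = (1 - t ^+ 2) / (1 + t ^+ 2) * dot a a.
    by rewrite /dot/= ?regular_scaleE; ring.
  have pu : dot (perp a) u = (2 * t / (1 + t ^+ 2)) * dot a a.
    by rewrite /dot/= ?regular_scaleE; ring.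
  have uu : dot u u = dot a a.
    by rewrite /dot/= ?regular_scaleE; field.
  have auE : 1 + 2 * dot a u = 2 / (1 + t ^+ 2) by rewrite au a1; field.
  split; first by rewrite uu.
    by rewrite auE mulf_neq0 ?invr_neq0.
  by rewrite auE pu a1; field.
have uE u : dot u u = 2^-1 -> 1 + 2 * dot a u != 0 ->
   let t := 2 * dot (perp a) u / (1 + 2 * dot a u) in
   ((1 - t ^+ 2) / (1 + t ^+ 2)) *: a + (2 * t / (1 + t ^+ 2)) *: perp a = u.
  move=> u1 au0 t.
  have sq : (2 * dot a u) ^+ 2 + (2 * dot (perp a) u) ^+ 2 = 1.
    transitivity (4 * dot a a * dot u u); first by rewrite /dot/perp/=; ring.
    by rewrite a1 u1; field.
  have t20 : 1 + t ^+ 2 != 0 by rewrite gt_eqF// ltr_wpDr ?sqr_ge0.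
  have t2E : 1 + t ^+ 2 = 2 / (1 + 2 * dot a u).
    have -> : t ^+ 2 = (1 - (2 * dot a u) ^+ 2) / (1 + 2 * dot a u) ^+ 2.
      rewrite /t expr_div_n; congr (_ / _).
      by apply/eqP; rewrite eq_sym subr_eq addrC sq.
    by field.
  have E1 : (1 - t ^+ 2) / (1 + t ^+ 2) = 2 * dot a u.
    have -> : 1 - t ^+ 2 = 2 - (1 + t ^+ 2) by ring.
    by rewrite mulrBl divff// t2E; field.
  have E2 : 2 * t / (1 + t ^+ 2) = 2 * dot (perp a) u.
    by rewrite t2E /t; field.
  rewrite E1 E2; move: a1.
  clear gE; case: u {u1 au0 t sq t20 t2E E1 E2} => [x y].
  case: a => [a b]; rewrite /dot/= => ab.
  congr pair; rewrite /= !regular_scaleE.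
    transitivity (2 * (a * a + b * b) * x); first by ring.
    by rewrite ab; field.
  transitivity (2 * (a * a + b * b) * y); first by ring.
  by rewrite ab; field.
split; first split.
- move=> u t _; rewrite /parabolic/=.
  by case: (gE (2 * dot (perp a) u / (1 + 2 * dot a u) + t)).
- by move=> u [u1 au0]; rewrite /parabolic/= addr0 uE.
- move=> u s t [u1 au0]; rewrite {1}/parabolic/=.
  case: (gE (2 * dot (perp a) u / (1 + 2 * dot a u) + s)) => _ _ E.
  by rewrite {1 2 3}/parabolic/= E /parabolic/= addrA.
move=> u v [u1 au0] [v1 av0].
exists (2 * dot (perp a) v / (1 + 2 * dot a v)
  - 2 * dot (perp a) u / (1 + 2 * dot a u)).
by rewrite /parabolic/= [_ + (_ - _)]addrC subrK uE.
Qed.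

(** * Products of plane vectors and the choice of an arc *)

Lemma dotZ (a : R) u v : dot (a *: u) (a *: v) = a ^+ 2 * dot u v.
Proof. by rewrite /dot/= !regular_scaleE; ring. Qed.

Lemma dotZl (a : R) u v : dot (a *: u) v = a * dot u v.
Proof. by rewrite /dot/= !regular_scaleE; ring. Qed.

Lemma dotBr u v w : dot u (v - w) = dot u v - dot u w.
Proof. by rewrite /dot/=; ring. Qed.

Lemma dotZr (a : R) u v : dot u (a *: v) = a * dot u v.
Proof. by rewrite /dot/= !regular_scaleE; ring. Qed.

Lemma dot_eq0 u : dot u u = 0 -> u = 0.
Proof.
case: u => x y; rewrite /dot/= => xy0.
have /eqP : x * x + y * y = 0 by [].
rewrite paddr_eq0 -?expr2 ?sqr_ge0// !sqrf_eq0 => /andP[/eqP -> /eqP ->].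
by [].
Qed.

Lemma dot_ge0 u : 0 <= dot u u.
Proof. by rewrite /dot -!expr2 addr_ge0 ?sqr_ge0. Qed.

(** Pythagoras in the orthogonal frame [n], [perp n]; it serves below as Cauchy-Schwarz with an
    explicit defect. *)
Lemma dot_perp_sqr n u :
  dot n u ^+ 2 + dot (perp n) u ^+ 2 = dot n n * dot u u.
Proof. by rewrite /dot/=; ring. Qed.

(* When [dot n n = N], the circle has to lose one of the two antipodal points
   collinear with [n]. *)
Lemma arc_flow n (N : R) : 0 < N -> dot n n <= N ->
  exists (U : set (plane R)) (g : plane R * R -> plane R),
  [/\ U `<=` [set u | dot u u = 2^-1], transitive_flow _ U g,
      forall u t, U u -> {for (u, t), continuous g},
      forall u, dot u u = 2^-1 -> U u \/ (dot n u ^+ 2 = N / 2 /\ U (- u))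
    & forall u, dot n u ^+ 2 = N / 2 -> U u -> ~ U (- u)].
Proof.
move=> N0; rewrite le_eqVlt => /predU1P[nN|nN]; last first.
  exists [set u | dot u u = 2^-1], rotation; split => //.
  - exact: rotation_flow.
  - by move=> u t _; exact: rotation_continuous.
  - by move=> u; left.
  (* By Cauchy-Schwarz [dot n u ^+ 2 <= dot n n / 2 < N / 2], which contradicts [h]. *)
  - move=> u h /= u1; have := dot_perp_sqr n u; rewrite u1 h.
    by have := sqr_ge0 (dot (perp n) u); lra.
have s0 : Num.sqrt (2 * N) != 0 by rewrite sqrtr_eq0 -ltNge mulr_gt0.
have s2 : Num.sqrt (2 * N) ^+ 2 = 2 * N by rewrite sqr_sqrtr// mulr_ge0// ltW.
(* [n] rescaled to squared length 1/2. On the circle, [dot n u ^+ 2 = N / 2] holds only at [a] and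
   [- a], and the arc omits [- a]. *)
pose a := (Num.sqrt (2 * N))^-1 *: n.
have a1 : dot a a = 2^-1.
  by rewrite /a dotZ nN exprVn s2; field; rewrite gt_eqF.
have nE u : dot n u ^+ 2 = N / 2 * (2 * dot a u) ^+ 2.
  by rewrite /a dotZl !exprMn exprVn s2; field; rewrite gt_eqF.
have aN u : dot a (- u) = - dot a u by rewrite /dot/=; ring.
exists [set u | dot u u = 2^-1 /\ 1 + 2 * dot a u != 0], (parabolic a); split.
- by move=> u [].
- exact: parabolic_flow.
- by move=> u t [_ ?]; exact: parabolic_continuous.
- move=> u u1; have [au|au] := eqVneq (1 + 2 * dot a u) 0; last by left.
  right; have au1 : 2 * dot a u = -1 by lra.
  split; first by rewrite nE au1 sqrrN expr1n mulr1.
  split; first by rewrite -u1 /dot/=; ring.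
  by rewrite aN mulrN au1 opprK gt_eqF.
- move=> u; rewrite nE /= aN => h [_ u0] [_ u0'].
  have /eqP : (2 * dot a u) ^+ 2 = 1.
    by apply: (mulfI (x := N / 2)); rewrite ?h ?mulr1// gt_eqF// divr_gt0.
  rewrite sqrf_eq1 => /orP[/eqP E|/eqP E].
    by move: u0'; rewrite mulrN E subrr eqxx.
  by move: u0; rewrite E subrr eqxx.
Qed.

(** * A section of the cone and its flow *)

Definition cone n1 n2 : set (plane R * plane R) :=
  [set X | dot X.1 X.1 = dot X.2 X.2 /\ dot n1 X.1 + dot n2 X.2 = 0].

(* The vector of squared length 1/2 with [dot n2 v = - dot n1 u] on the side
   [dot (perp n2) v >= 0]. *)
Definition partner n1 n2 u : plane R :=
  (Num.sqrt (dot n2 n2 / 2 - dot n1 u ^+ 2) / dot n2 n2) *: perp n2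
  - (dot n1 u / dot n2 n2) *: n2.

Lemma partner_continuous n1 n2 : continuous (partner n1 n2).
Proof.
move=> u; rewrite /partner.
have hc : dot n1 x @[x --> u] --> dot n1 u.
  by apply: cvg_dot; [exact: cvg_cst|exact: cvg_id].
apply: cvgB; (apply: cvgZ; last exact: cvg_cst);
  (apply: cvgM; last exact: cvg_cst) => //.
apply: (continuous_comp (f := fun x => dot n2 n2 / 2 - dot n1 x ^+ 2));
  last exact: sqrt_continuous.
by apply: cvgB; [exact: cvg_cst|exact: cvgM].
Qed.

(** The last clause makes [T] meet each line of the cone exactly once; two components of squared
    length 1/2 will give a parallelogram of norm 1. *)
Definition conformal_flow n1 n2 (T : set (plane R * plane R))
    (f : (plane R * plane R) * R -> plane R * plane R) : Prop :=
  [/\ forall X, T X -> cone n1 n2 X /\ dot X.1 X.1 = 2^-1,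
      transitive_flow _ T f,
      forall X t, T X -> {for (X, t), continuous f}
    & forall X, cone n1 n2 X -> X != 0 ->
        exists! Y, T Y /\ exists c : R, X = c *: Y].

Lemma perp_decomposition n u :
  dot n n *: u = dot n u *: n + dot (perp n) u *: perp n.
Proof.
case: u n => [x y] [a b]; rewrite /dot.
by congr pair; rewrite /= !regular_scaleE; ring.
Qed.

(** The section is the graph of [partner n1 n2] over the arc [U]. On a line of the cone,
    normalization leaves two opposite points; the sign of [dot (perp n2) v] selects one, and where
    it vanishes [U] decides. *)
Lemma cone_flow_le n1 n2 : n2 != 0 -> dot n1 n1 <= dot n2 n2 ->
  exists T f, conformal_flow n1 n2 T f.
Proof.
move=> n20 n12; set N := dot n2 n2.
have N0 : 0 < N.
  by rewrite lt0r dot_ge0 andbT; apply: contra_neq n20; exact: dot_eq0.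
have [U [g [U1 [[gU g0 gD] gtr] gc Ucov Uanti]]] := arc_flow n1 N N0 n12.
pose G := partner n1 n2.
have N00 : N != 0 by rewrite gt_eqF.
(* The radicand in [partner] is nonnegative by Cauchy-Schwarz and [dot n1 n1 <= N]. *)
have h2 u : dot u u = 2^-1 -> 0 <= N / 2 - dot n1 u ^+ 2.
  move=> u1; have := dot_perp_sqr n1 u; rewrite u1.
  by have := sqr_ge0 (dot (perp n1) u); move: n12; rewrite -/N; lra.
have nG u : dot n2 (G u) = - dot n1 u.
  rewrite /G /partner dotBr !dotZr.
  have -> : dot n2 (perp n2) = 0 by rewrite /dot/=; ring.
  by rewrite mulr0 sub0r -/N divfK.
have pG u : dot (perp n2) (G u) = Num.sqrt (N / 2 - dot n1 u ^+ 2).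
  rewrite /G /partner dotBr !dotZr.
  have -> : dot (perp n2) n2 = 0 by rewrite /dot/=; ring.
  have -> : dot (perp n2) (perp n2) = N by rewrite /N /dot/=; ring.
  by rewrite mulr0 subr0 -/N divfK.
have GE u v : dot n2 v = - dot n1 u ->
    dot (perp n2) v = Num.sqrt (N / 2 - dot n1 u ^+ 2) -> v = G u.
  move=> e1 e2; apply: (scalerI N00).
  by rewrite !perp_decomposition nG pG e1 e2.
have GG u : dot u u = 2^-1 -> dot (G u) (G u) = 2^-1.
  move=> u1; apply: (mulfI N00).
  by rewrite -dot_perp_sqr nG pG sqr_sqrtr ?h2// sqrrN addrC subrK.
exists [set X | U X.1 /\ X.2 = G X.1],
  (fun p => (g (p.1.1, p.2), G (g (p.1.1, p.2)))); split => /=.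
- move=> [u v] /= [uU ->]; rewrite /cone/= nG subrr.
  by split; [split=> //; rewrite GG|]; exact: U1.
- split; first split => /=.
  + by move=> [u v] t /= [uU _]; split => //; exact: gU.
  + by move=> [u v] /= [uU ->]; rewrite g0.
  + by move=> [u v] s t /= [uU _]; rewrite gD.
  + move=> [u v] [u' v'] /= [uU _] [u'U ->].
    by have [t tE] := gtr _ _ uU u'U; exists t; rewrite tE.
- move=> [u v] t /= [uU _].
  have gc' : {for ((u, v), t), continuous
      (fun p : (plane R * plane R) * R => g (p.1.1, p.2))}.
    apply: (continuous_comp
      (f := fun p : (plane R * plane R) * R => (p.1.1, p.2))); last exact: gc.
    exact: (cvg_pair (cvg_comp _ _ cvg_fst cvg_fst) cvg_snd).
  exact: (cvg_pair gc' (continuous_comp gc' (partner_continuous n1 n2 _))).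
move=> [x y] [/= xy nxy] X0.
set k := dot (perp n2) y; set r := dot x x.
have r0 : 0 < r.
  rewrite lt0r dot_ge0 andbT; apply: contra_neq X0 => r0.
  by rewrite (dot_eq0 _ r0) (dot_eq0 y) // -xy.
have kE : k ^+ 2 = N * r - dot n1 x ^+ 2.
  have := dot_perp_sqr n2 y; rewrite -xy.
  have -> : dot n2 y = - dot n1 x by lra.
  by rewrite sqrrN -/k -/r -/N => <-; rewrite addrAC subrr add0r.
(* The condition on [c ^+ 2] normalizes [x] to squared length 1/2, and [0 <= k / c] puts the
   rescaled [y] on the side chosen by [partner]. *)
have sol c : c ^+ 2 = 2 * r -> 0 <= k / c -> U (c^-1 *: x) ->
    exists Y : plane R * plane R,
      (U Y.1 /\ Y.2 = G Y.1) /\ exists c : R, (x, y) = c *: Y.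
  move=> c2 kc Ux.
  have c0 : c != 0 by rewrite -sqrf_eq0 c2 mulf_neq0// gt_eqF.
  exists (c^-1 *: (x, y)); split; last first.
    by exists c; rewrite scalerA divff// scale1r.
  split=> //=; apply: GE; rewrite !dotZr.
    by have -> : dot n2 y = - dot n1 x by [lra]; rewrite mulrN.
  rewrite -/k mulrC -[LHS]ger0_norm// -sqrtr_sqr; congr Num.sqrt.
  rewrite exprMn exprVn c2 kE exprMn exprVn c2.
  by field; rewrite gt_eqF.
have [Y YT] : exists Y : plane R * plane R,
      (U Y.1 /\ Y.2 = G Y.1) /\ exists c : R, (x, y) = c *: Y.
  have [c c2 kc] : exists2 c, c ^+ 2 = 2 * r & 0 <= k / c.
    have s2 : Num.sqrt (2 * r) ^+ 2 = 2 * r.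
      by rewrite sqr_sqrtr// mulr_ge0// ltW.
    case: (leP 0 k) => k0.
      by exists (Num.sqrt (2 * r)); rewrite ?divr_ge0 ?sqrtr_ge0.
    exists (- Num.sqrt (2 * r)); rewrite ?sqrrN//.
    by rewrite invrN mulrN -mulNr divr_ge0 ?sqrtr_ge0// oppr_ge0 ltW.
  have c0 : c != 0 by rewrite -sqrf_eq0 c2 mulf_neq0// gt_eqF.
  have x1 : dot (c^-1 *: x) (c^-1 *: x) = 2^-1.
    by rewrite dotZ exprVn c2 -/r; field; rewrite gt_eqF.
  have [/(sol _ c2 kc)//|[hN NU]] := Ucov _ x1.
  (* The arc misses only a point where [k = 0], so the opposite factor satisfies the sign condition
     too. *)
  apply: (sol (- c)); rewrite ?sqrrN// ?invrN ?scaleNr//.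
  suff -> : k = 0 by rewrite mul0r.
  apply/eqP; rewrite -sqrf_eq0 kE subr_eq0; apply/eqP.
  move: hN; rewrite dotZr exprMn exprVn c2 => hN.
  apply: (mulfI (x := (2 * r)^-1)).
    by rewrite invr_eq0 mulf_neq0// gt_eqF.
  by rewrite hN; field; rewrite gt_eqF.
exists Y; split=> //; case: Y YT => u v /= [[uU ->] [c cE]].
move=> [u' v'] [/= [u'U ->]] [c' cE'].
have c0 : c != 0 by apply: contra_neq X0 => c0; rewrite cE c0 scale0r.
have xE : x = c *: u := congr1 fst cE; have yE : y = c *: G u := congr1 snd cE.
have xE' : x = c' *: u' := congr1 fst cE'.
have yE' : y = c' *: G u' := congr1 snd cE'.
have cc : c ^+ 2 = c' ^+ 2.
  apply: (mulIf (x := 2^-1)); first by rewrite invr_eq0.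
  by rewrite -{1}(U1 _ uU) -(U1 _ u'U) -!dotZ -xE -xE'.
have /orP[/eqP c'E|/eqP c'E] : (c' == c) || (c' == - c) by rewrite -eqf_sqr cc.
  by have -> : u = u' by apply: (scalerI c0); rewrite -xE xE' c'E.
(* If the two points are opposite, their nonnegative products with [perp n2] are opposite as well,
   hence zero. Then [dot n1 u ^+ 2 = N / 2], where the arc contains no antipodal pair. *)
have uu' : u' = - u.
  by apply: (scalerI c0); rewrite scalerN -xE xE' c'E scaleNr opprK.
have GG' : G u' = - G u.
  by apply: (scalerI c0); rewrite scalerN -yE yE' c'E scaleNr opprK.
case: (Uanti u _ uU); last by rewrite -uu'.
have := pG u'; rewrite GG' uu'.
have dotNr a b : dot a (- b) = - dot a b by rewrite /dot/=; ring.
rewrite !dotNr pG sqrrN => sN.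
have : Num.sqrt (N / 2 - dot n1 u ^+ 2) = 0 by lra.
by move/eqP; rewrite sqrtr_eq0 => le0; have := h2 _ (U1 _ uU); lra.
Qed.

(** Exchanging the two components reduces to the case where [n2] is the longer normal. *)
Lemma cone_flow n1 n2 : n1 != 0 \/ n2 != 0 ->
  exists T f, conformal_flow n1 n2 T f.
Proof.
move=> n0.
have [le12|/ltW le21] := leP (dot n1 n1) (dot n2 n2).
  apply: cone_flow_le => //; case: n0 => // n10.
  apply: contra_neq n10 => n20; apply: dot_eq0; apply/eqP.
  by rewrite eq_le dot_ge0 andbT (le_trans le12)// n20 /dot/= mul0r addr0.
have n10 : n1 != 0.
  case: n0 => // n20.
  apply: contra_neq n20 => n10; apply: dot_eq0; apply/eqP.
  by rewrite eq_le dot_ge0 andbT (le_trans le21)// n10 /dot/= mul0r addr0.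
have [T [f [T1 [[fT f0 fD] ftr] fc fu]]] := cone_flow_le _ _ n10 le21.
exists [set X | T (X.2, X.1)],
  (fun p => let Y := f ((p.1.2, p.1.1), p.2) in (Y.2, Y.1)); split => /=.
- move=> [u v] /= /T1[[/= e1 e2] e3].
  by split; [split => //=; rewrite addrC|rewrite -e1].
- split; first split => /=.
  + by move=> [u v] t /= uT; have := fT _ t uT; case: (f _).
  + by move=> [u v] /= uT; rewrite f0.
  + by move=> [u v] s t /= uT; rewrite -fD//; case: (f (_, s)).
  + move=> [u v] [u' v'] /= uT u'T.
    by have [t tE] := ftr _ _ uT u'T; exists t; rewrite tE.
- move=> [u v] t /= uT.
  have fc' : {for ((u, v), t), continuous
      (fun p : (plane R * plane R) * R => f ((p.1.2, p.1.1), p.2))}.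
    apply: (continuous_comp
      (f := fun p : (plane R * plane R) * R => ((p.1.2, p.1.1), p.2)));
      last exact: fc.
    exact: (cvg_pair (cvg_pair (cvg_comp _ _ cvg_fst cvg_snd)
      (cvg_comp _ _ cvg_fst cvg_fst)) cvg_snd).
  exact: (cvg_pair (cvg_comp _ _ fc' cvg_snd) (cvg_comp _ _ fc' cvg_fst)).
move=> [u v] [/= e1 e2] uv0.
have [||[u' v'] [[/= YT [c cE]] Yu]] := fu (v, u).
- by split => //=; rewrite addrC.
- by apply: contra_neq uv0 => -[-> ->].
exists (v', u'); split; first by split => //; exists c; move: cE => [-> ->].
move=> [v'' u''] [/= YT' [c' c'E]].
have [-> ->//] : (u', v') = (u'', v'').
by apply: Yu; split => //; exists c'; move: c'E => [-> ->].
Qed.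

(** * Isotropic vectors of a difference of squared lengths *)

Definition cross u v : R := dot (perp u) v.

(* Identifying vectors with complex numbers, if the two cross products agree
   then the discriminant of |a u1 + b u2|^2 - |a v1 + b v2|^2 as a quadratic
   form in a, b is 4 |u1 v2 - u2 v1|^2. *)
Lemma isotropic_pair u1 u2 v1 v2 : cross u1 u2 = cross v1 v2 ->
  exists a b : R, (a != 0 \/ b != 0) /\
    dot (a *: u1 + b *: u2) (a *: u1 + b *: u2) =
    dot (a *: v1 + b *: v2) (a *: v1 + b *: v2).
Proof.
move=> cE.
pose e := dot u1 u1 - dot v1 v1.
pose f := dot u1 u2 - dot v1 v2.
pose g := dot u2 u2 - dot v2 v2.
have qE (a b : R) : dot (a *: u1 + b *: u2) (a *: u1 + b *: u2) -
    dot (a *: v1 + b *: v2) (a *: v1 + b *: v2) =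
    e * a ^+ 2 + 2 * f * a * b + g * b ^+ 2.
  by rewrite /e /f /g /dot/= !regular_scaleE; ring.
suff [a [b [ab0 q0]]] : exists a b : R, (a != 0 \/ b != 0) /\
    e * a ^+ 2 + 2 * f * a * b + g * b ^+ 2 = 0.
  by exists a, b; split => //; apply/eqP; rewrite -subr_eq0 qE q0.
have [e0|e0] := eqVneq e 0.
  by exists 1, 0; split; [left; rewrite oner_eq0|rewrite e0; ring].
have disc : 0 <= f ^+ 2 - e * g.
  have -> : f ^+ 2 - e * g =
      (u1.1 * v2.1 - u1.2 * v2.2 - (u2.1 * v1.1 - u2.2 * v1.2)) ^+ 2 +
      (u1.1 * v2.2 + u1.2 * v2.1 - (u2.1 * v1.2 + u2.2 * v1.1)) ^+ 2 -
      (cross u1 u2 - cross v1 v2) ^+ 2.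
    by rewrite /e /f /g /cross /dot/=; ring.
  by rewrite cE subrr expr0n subr0 addr_ge0 ?sqr_ge0.
(* A root of the quadratic equation in [a] obtained for [b = 1]. *)
exists ((- f + Num.sqrt (f ^+ 2 - e * g)) / e), 1; split.
  by right; rewrite oner_eq0.
have := sqr_sqrtr disc; set s := Num.sqrt _ => s2.
transitivity ((s ^+ 2 - (f ^+ 2 - e * g)) / e); first by field.
by rewrite s2 subrr mul0r.
Qed.

(** * Parallelograms recovered from their diagonals *)

Variable K : config R.
Implicit Types (P Q : quad R).

Definition diagonals P : plane R * plane R := (diagAC P, diagBD P).

(* The solution c of c - u / 2 in C, c - v / 2 in D. *)
Definition centre (X : plane R * plane R) : plane R :=
  let x := (dot (mC K, -1) X.1 - dot (mD K, -1) X.2) / (2 * (mC K - mD K)) in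
  (x, mD K * x - dot (mD K, -1) X.2 / 2).

Definition of_diagonals (X : plane R * plane R) : quad R :=
  (centre X + 2^-1 *: X.1, centre X + 2^-1 *: X.2,
   centre X - 2^-1 *: X.1, centre X - 2^-1 *: X.2).

Lemma diagonals_of_diagonals X : diagonals (of_diagonals X) = X.
Proof.
rewrite /diagonals /diagAC /diagBD /of_diagonals /vA /vB /vC /vD /=.
case: X (centre X) => [[u1 u2] [v1 v2]] [c1 c2].
by congr ((_, _), (_, _)); rewrite /= !regular_scaleE; field.
Qed.

(* With the centre and the scale expressed through the diagonals, the condition
   that the vertex on A does lie on A becomes (twice)
   [dot normalAC X.1 + dot normalBD X.2 = 0]. *)
Definition slope_coef : R :=
  ((mD K - mA K) - bA K * (mD K - mB K)) / (mC K - mD K).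
Definition normalAC : plane R :=
  (slope_coef * mC K - mA K, 1 - slope_coef).
Definition normalBD : plane R :=
  (- slope_coef * mD K - mD K + bA K * (mD K + mB K),
   slope_coef + 1 - 2 * bA K).

Hypothesis CD_neq : mC K - mD K != 0.

(** If both normals vanished, A would be parallel to C and B to D with [bA K = 1]; the definition of
    [slope_coef] then gives -1, the normals 1. *)
Lemma normal_neq0 : normalAC != 0 \/ normalBD != 0.
Proof.
have [n1|] := eqVneq normalAC 0; last by left.
right; apply/eqP => n2.
have k1 : slope_coef = 1.
  by have : normalAC.2 = 0 := congr1 snd n1; rewrite /=; lra.
have bA1 : bA K = 1.
  by have : normalBD.2 = 0 := congr1 snd n2; rewrite /= k1; lra.
have AC : mA K = mC K.
  by have : normalAC.1 = 0 := congr1 fst n1; rewrite /= k1; lra.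
have BD : mB K = mD K.
  by have : normalBD.1 = 0 := congr1 fst n2; rewrite /= k1 bA1; lra.
have : slope_coef = -1 by rewrite /slope_coef bA1 AC BD; field.
by rewrite k1; lra.
Qed.

Lemma inscribed_of_diagonals X : dot normalAC X.1 + dot normalBD X.2 = 0 ->
  Pi K (of_diagonals X).
Proof.
case: X => [[u1 u2] [v1 v2]] nX.
pose c := centre ((u1, u2), (v1, v2)).
(* The scale is the intercept of the line of slope [mB K] through the vertex [c + v / 2]. *)
exists (c.2 - mB K * c.1 + (v2 - mB K * v1) / 2).
have d2 : 2 * (mC K - mD K) != 0 by rewrite mulf_neq0.
split.
- rewrite /lineA /line/= !regular_scaleE /c /centre /dot/=.
  apply/eqP; rewrite -subr_eq0; apply/eqP.
  move: nX; rewrite /dot/= /slope_coef => nX.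
  apply: (mulfI (x := 2)) => //; rewrite mulr0 -[RHS]nX; field.
  by [].
- by rewrite /lineB /line/= !regular_scaleE /c /centre /dot/=; field.
- by rewrite /lineC /line/= !regular_scaleE /c /centre /dot/=; field.
- by rewrite /lineD /line/= !regular_scaleE /c /centre /dot/=; field.
- by congr pair; rewrite /= !regular_scaleE; ring.
Qed.

(** Both diagonals have the same midpoint, and the lines C and D, not being parallel, determine it
    from the diagonal vectors. *)
Lemma of_diagonalsK P : Pi K P -> of_diagonals (diagonals P) = P.
Proof.
case: P => [[[[a1 a2] [b1 b2]] [c1 c2]] [d1 d2]] [w].
rewrite /inscribed_at/lineA/lineB/lineC/lineD/line/=.
rewrite /vA/vB/vC/vD/= => -[EA EB EC ED [s1 s2]].
have {}s1 : a1 + c1 = b1 + d1 := s1.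
have {}s2 : a2 + c2 = b2 + d2 := s2.
have cE : centre (diagonals (((a1, a2), (b1, b2), (c1, c2)), (d1, d2))) =
    ((a1 + c1) / 2, (a2 + c2) / 2).
  rewrite /centre /diagonals /diagAC /diagBD /dot /vA /vB /vC /vD /=.
  have -> : (mC K * (a1 - c1) + -1 * (a2 - c2) -
      (mD K * (b1 - d1) + -1 * (b2 - d2))) / (2 * (mC K - mD K)) =
      (a1 + c1) / 2.
    apply: (mulIf (x := 2 * (mC K - mD K))); first by rewrite mulf_neq0.
    rewrite divfK ?mulf_neq0//; nra.
  congr pair; nra.
rewrite /of_diagonals cE.
by congr ((((_, _), (_, _)), (_, _)), (_, _)); rewrite /= !regular_scaleE; lra.
Qed.

Lemma diagonals_normal P : Pi K P ->
  dot normalAC (diagAC P) + dot normalBD (diagBD P) = 0.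
Proof.
case: P => [[[[a1 a2] [b1 b2]] [c1 c2]] [d1 d2]] [w].
rewrite /inscribed_at/lineA/lineB/lineC/lineD/line/=.
rewrite /diagAC/diagBD/vA/vB/vC/vD/dot/= /slope_coef.
move=> [EA EB EC ED [s1 s2]].
have {}s1 : a1 + c1 = b1 + d1 := s1.
have {}s2 : a2 + c2 = b2 + d2 := s2.
have {}EA : a2 = mA K * a1 + bA K * w := EA.
have {}EB : b2 = mB K * b1 + w := EB.
have {}EC : c2 = mC K * c1 := etrans EC (addr0 _).
have {}ED : d2 = mD K * d1 := etrans ED (addr0 _).
(* Eliminating [d1] and [c1] leaves a rational identity in [a1], [b1] and [w]. *)
have d1E : d1 = a1 + c1 - b1 by lra.
have bE : w = mA K * a1 + bA K * w + mC K * c1 - mB K * b1 - mD K * d1 by lra.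
have c1E : c1 =
    (w - mA K * a1 - bA K * w + mB K * b1 + mD K * (a1 - b1)) / (mC K - mD K).
  apply: (mulIf CD_neq); rewrite divfK//; move: bE; rewrite d1E; lra.
by rewrite EA EB EC ED d1E c1E; field.
Qed.

Lemma of_diagonalsZ (c : R) X : of_diagonals (c *: X) = c *: of_diagonals X.
Proof.
case: X => [[u1 u2] [v1 v2]]; rewrite /of_diagonals /centre /dot.
by congr ((((_, _), (_, _)), (_, _)), (_, _)); rewrite /= !regular_scaleE; ring.
Qed.

Lemma diagonalsZ (c : R) P : diagonals (c *: P) = c *: diagonals P.
Proof.
by rewrite /diagonals /diagAC /diagBD /=; congr pair; rewrite /= scalerBr.
Qed.

Lemma diagonals_continuous : continuous diagonals.
Proof.
move=> P.
have cD : vD Q @[Q --> P] --> vD P by exact: cvg_snd.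
have cABC : Q.1 @[Q --> P] --> P.1 by exact: cvg_fst.
have cC : vC Q @[Q --> P] --> vC P by exact: (cvg_comp _ _ cABC cvg_snd).
have cAB : Q.1.1 @[Q --> P] --> P.1.1 by exact: (cvg_comp _ _ cABC cvg_fst).
have cA : vA Q @[Q --> P] --> vA P by exact: (cvg_comp _ _ cAB cvg_fst).
have cB : vB Q @[Q --> P] --> vB P by exact: (cvg_comp _ _ cAB cvg_snd).
exact: (cvg_pair (cvgB cA cC) (cvgB cB cD)).
Qed.

Lemma of_diagonals_continuous : continuous of_diagonals.
Proof.
move=> X.
have uc : Y.1 @[Y --> X] --> X.1 by exact: cvg_fst.
have vc : Y.2 @[Y --> X] --> X.2 by exact: cvg_snd.
have dvc : dot (mD K, -1) Y.2 @[Y --> X] --> dot (mD K, -1) X.2.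
  by apply: cvg_dot => //; exact: cvg_cst.
have xc : (centre Y).1 @[Y --> X] --> (centre X).1.
  apply: cvgM; last exact: cvg_cst.
  by apply: cvgB => //; apply: cvg_dot => //; exact: cvg_cst.
have yc : (centre Y).2 @[Y --> X] --> (centre X).2.
  by apply: cvgB; apply: cvgM => //; exact: cvg_cst.
have cc : centre Y @[Y --> X] --> centre X by exact: (cvg_pair xc yc).
have uc2 : 2^-1 *: Y.1 @[Y --> X] --> 2^-1 *: X.1.
  by apply: cvgZ => //; exact: cvg_cst.
have vc2 : 2^-1 *: Y.2 @[Y --> X] --> 2^-1 *: X.2.
  by apply: cvgZ => //; exact: cvg_cst.
exact: (cvg_pair (cvg_pair (cvg_pair (cvgD cc uc2) (cvgD cc vc2)) (cvgB cc uc2))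
  (cvgB cc vc2)).
Qed.

Lemma rectangleP P : rectangle K P <->
  Pi K P /\ cone normalAC normalBD (diagonals P).
Proof.
rewrite /rectangle /cone /vlength /=; split => -[PiP].
  move=> sE; split => //; split; last exact: diagonals_normal.
  by move/eqP: sE; rewrite eqr_sqrt ?dot_ge0// => /eqP.
by move=> [-> _].
Qed.

(** * A rectangle at infinity *)

Lemma rectangle_at_infinity :
  exists P, [/\ rectangle K P, P != 0 & at_infinity K P].
Proof.
pose d := mC K - mD K.
(* At scale 0 the abscissae [a], [b] on A and B are free. The diagonals for (1, 0) are [u1], [v1],
   those for (0, 1) are [u2], [v2]. *)
pose u1 : plane R := (1 + (mA K - mD K) / d, mA K + mC K * (mA K - mD K) / d).
pose u2 : plane R := (- (mB K - mD K) / d, - mC K * (mB K - mD K) / d).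
pose v1 : plane R := ((mA K - mC K) / d, mD K * (mA K - mC K) / d).
pose v2 : plane R := (1 - (mB K - mC K) / d, mB K - mD K * (mB K - mC K) / d).
have [|a [b [ab0 q0]]] := isotropic_pair u1 u2 v1 v2.
  (* Vertices on the same line through the origin have cross product 0, so both sides equal minus
     the cross product of the sums of opposite vertices. *)
  by rewrite /cross /dot/= /d; field.
pose c := ((mB K - mD K) * b - (mA K - mD K) * a) / d.
pose e := ((mB K - mC K) * b - (mA K - mC K) * a) / d.
pose P : quad R := ((a, mA K * a), (b, mB K * b), (c, mC K * c), (e, mD K * e)).
have P0 : at_infinity K P.
  split; try by rewrite /lineA/lineB/lineC/lineD/line/=; ring.
  by rewrite /vA/vB/vC/vD/P; congr pair; rewrite /= /c /e /d; field.
exists P; split => //.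
  split; first by exists 0.
  rewrite /vlength; congr Num.sqrt.
  have -> : diagAC P = a *: u1 + b *: u2.
    by congr pair; rewrite /= !regular_scaleE /c /d; field.
  rewrite q0.
  have -> // : diagBD P = a *: v1 + b *: v2.
  by congr pair; rewrite /= !regular_scaleE /e /d; field.
by apply/eqP => -[a0 _ b0 _ _ _ _ _]; case: ab0; rewrite ?a0 ?b0 eqxx.
Qed.

End ConformalFlow.

(** * Transfer of the flow to [Pi] *)

Theorem corollary4p3 (R : realType) (K : config R)
  (not_concurrent : ~ exists p : plane R,
     lineA K 1 `&` lineB K 1 `&` lineC K 1 `&` lineD K 1 = [set p])
  (CD_origin : lineC K 1 `&` lineD K 1 = [set 0]) :
  exists (S : set (quad R)) (f : quad R * R -> quad R),
    [/\ S `<=` unit_rectangle K,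
        continuous_flow_on S f,
        conformal_solution K S
      & passes_through_infinity K S f].
Proof.
have d0 : mC K - mD K != 0.
  (* With equal slopes, C and D would also share the point (1, [mD K]). *)
  apply/eqP => /subr0_eq CD.
  have : [set 0 : plane R] (1, mD K).
    by rewrite -CD_origin /lineC /lineD /line /= CD mulr1 addr0.
  by move=> /(congr1 fst)/= /eqP; rewrite oner_eq0.
have [T [h [T1 [[hT h0 hD] htr] hc hu]]] :=
  cone_flow R _ _ (normal_neq0 R K d0).
pose S : set (quad R) := [set P | Pi K P /\ T (diagonals R P)].
have ST X : T X -> S (of_diagonals R K X).
  move=> TX; rewrite /S/= diagonals_of_diagonals; split => //.
  by apply: (inscribed_of_diagonals R K d0); case: (T1 _ TX) => -[].
have SR P : S P -> rectangle K P.
  by move=> [PiP /T1[PC _]]; apply/(rectangleP R K d0).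
have uniqS P : rectangle K P -> P != 0 -> exists! Q, S Q /\ scaled_from P Q.
  move=> /(rectangleP R K d0)[PiP PC] P0.
  have X0 : diagonals R P != 0.
    apply: contra_neq P0 => X0.
    rewrite -(of_diagonalsK R K d0 P PiP) X0.
    by rewrite -(scale0r 0) of_diagonalsZ scale0r.
  have [Y [[TY [c cE]] Yu]] := hu _ PC X0.
  exists (of_diagonals R K Y); split.
    split; first exact: ST.
    by exists c; rewrite -of_diagonalsZ -cE (of_diagonalsK R K d0).
  move=> Q [[PiQ TQ] [c' c'E]].
  rewrite (Yu (diagonals R Q)) ?(of_diagonalsK R K d0)//; split => //.
  by exists c'; rewrite c'E diagonalsZ.
exists S, (fun p => of_diagonals R K (h (diagonals R p.1, p.2))); split.
- move=> P SP; split; first exact: SR.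
  case: SP => _ /T1[[e1 _] e2].
  have {}e2 : dot (diagAC P) (diagAC P) = 2^-1 := e2.
  have {}e1 : dot (diagAC P) (diagAC P) = dot (diagBD P) (diagBD P) := e1.
  rewrite /qnorm /inner -e1 e2 (_ : 2^-1 + 2^-1 = 1) ?sqrtr1//.
  by field.
- split; first split.
  + by move=> P t [_ TP]; apply: ST; exact: hT.
  + by move=> P [PiP TP] /=; rewrite h0// (of_diagonalsK R K d0).
  + by move=> P s t [PiP TP] /=; rewrite diagonals_of_diagonals hD.
  apply: continuous_in_subspaceT => -[P t]; rewrite inE => -[[_ TP] _].
  have c1 : {for (P, t), continuous
      (fun p : quad R * R => (diagonals R p.1, p.2))}.
    have c1 : diagonals R p.1 @[p --> (P, t)] --> diagonals R P.
      by apply: (cvg_comp _ _ cvg_fst); exact: diagonals_continuous.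
    exact: (cvg_pair c1 cvg_snd).
  apply: (continuous_comp
    (f := fun p : quad R * R => h (diagonals R p.1, p.2))).
    by apply: (continuous_comp c1); exact: hc.
  exact: of_diagonals_continuous.
- split => //.
  + move=> P [PR P0 _].
    by have [Q [[SQ QP] _]] := uniqS P PR P0; exists Q.
  (* Uniqueness holds for every nonzero rectangle, so the exceptional set is empty. *)
  + by move=> P Q [[PR P0 _]] []; exact: uniqS.
- have [P [PR P0 Pinf]] := rectangle_at_infinity R K d0.
  have [Q [[SQ [c cE]] _]] := uniqS P PR P0.
  split; first by exists Q.
  (* By transitivity each trajectory reaches [Q], a multiple of [P]; scale 0 is preserved by scalar
     multiplication. *)
  move=> P' SP'; have [t tE] := htr _ _ SP'.2 SQ.2.
  exists t; rewrite /= tE (of_diagonalsK R K d0 Q SQ.1).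
  have c0 : c != 0 by apply: contra_neq P0 => c0; rewrite cE c0 scale0r.
  have -> : Q = c^-1 *: P by rewrite cE scalerA mulVf// scale1r.
  move: Pinf; clear; case: P => [[[[a1 a2] [b1 b2]] [c1 c2]] [d1 d2]].
  rewrite /at_infinity/inscribed_at/lineA/lineB/lineC/lineD/line/vA/vB/vC/vD/=.
  rewrite !regular_scaleE => -[-> -> -> -> [s1 s2]].
  have {}s1 : a1 + c1 = b1 + d1 := s1.
  split; try by ring.
  rewrite -scalerDr -[RHS]scalerDr; congr (_ *: _).
  exact: (congr2 pair s1 s2).
Qed.
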